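(* Let $n\ge 6$ be even. There is no classical protocol for $\mathrm{HM}_n$ (with countable message alphabet of arbitrary size and arbitrary public and private randomness) that simultaneously (1) solves $\mathrm{HM}_n$ with zero error, and (2) satisfies $I(X_S:C)=0$ (i.e. $X_S$ and $C$ are independent) for every $S\subseteq[n]$ with $|S|=4$. In particular, the task $\mathrm{PoHM}_n$ admits no zero-error classical protocol for any even $n\ge 6$; that is, no classical protocol solves $\mathrm{HM}_n$ with zero error and satisfies $I(X_S:C)=0$ for every $S\subseteq[n]$ with $|S|\ne 0,2$.
   Context: $[n]=\{1,\dots,n\}$ with $n$ an even positive integer. For $x\in\{0,1\}^n$ and $S\subseteq[n]$, $x_S:=\bigoplus_{i\in S}x_i$ (with $x_\emptyset=0$). A perfect matching of $[n]$ is a set of $n/2$ pairwise disjoint two-element subsets (edges) of $[n]$ with union $[n]$; $\mathscr{M}_n$ is the set of all perfect matchings. Hidden Matching $\mathrm{HM}_n$: Alice receives $x\in\{0,1\}^n$, Bob receives $\mathtt M\in\mathscr{M}_n$; Alice sends Bob one message; Bob outputs an edge $\{i,j\}\in\mathtt M$ and a bit $b$; the output is correct if $b=x_i\oplus x_j$. Classical protocol: (1) a random variable $R$ (public randomness), independent of $X$, with values in a countable set; (2) a conditional distribution $\Pr(\mathtt{Msg}=\zeta\mid X=x,R=r)$ on a countable message alphabet, from which Alice generates her message; (3) for each $(\zeta,r)$ and each $\mathtt M\in\mathscr{M}_n$, a probability distribution on pairs $(\{i,j\},b)$ with $\{i,j\}\in\mathtt M$, $b\in\{0,1\}$, from which Bob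 generates his output. Alice's input $X$ is uniform on $\{0,1\}^n$. Write $C:=(\mathtt{Msg},R)$ and $X_S:=\bigoplus_{i\in S}X_i$. Zero error: for every $x$, every $c$ with $\Pr(C=c\mid X=x)>0$, every $\mathtt M\in\mathscr{M}_n$, and every output $(\{i,j\},b)$ that Bob produces with positive probability given $C=c$ and input $\mathtt M$, one has $b=x_i\oplus x_j$. $I(\cdot:\cdot)$ is mutual information. $\mathrm{PoHM}_n$ is $\mathrm{HM}_n$ with the additional requirement $I(X_S:C)=0$ for every $S\subseteq[n]$ with $|S|\neq 0,2$. *)

(* Defs.v *)
From HB Require Import structures.
From mathcomp Require Import all_boot all_order all_algebra.
From mathcomp Require Import all_classical all_reals ereal numfun esum exp.

Set Implicit Arguments.
Unset Strict Implicit.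
Unset Printing Implicit Defensive.

Import Order.TTheory GRing.Theory Num.Theory.
Local Open Scope ring_scope.

Record distr (R : realType) (T : countType) := Distr {
  distr_mass :> T -> R ;
  distr_ge0 : forall t, 0 <= distr_mass t ;
  distr_sum1 : (\esum_(t in [set: T]%classic) (distr_mass t)%:E = 1)%E }.

Definition log2 (R : realType) (t : R) : R := ln t / ln 2.

Definition marginal1 (R : realType) (A B : countType) (q : A -> B -> R)
  (a : A) : R := fine (\esum_(b in [set: B]%classic) (q a b)%:E).

Definition marginal2 (R : realType) (A B : countType) (q : A -> B -> R)
  (b : B) : R := fine (\esum_(a in [set: A]%classic) (q a b)%:E).

Definition mutual_info_term (R : realType) (A B : countType) (q : A -> B -> R)
  (ab : A * B) : \bar R :=
  let: (a, b) := ab in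
  (q a b * log2 (q a b / (marginal1 q a * marginal2 q b)))%:E.

(* Mutual information I(A : B), in bits, of a pair (A, B) of discrete random
   variables with joint mass function [q].  [\esum] is a supremum of finite
   partial sums, hence meaningful only for nonnegative terms: the signed series
   is summed as (positive part) - (negative part).  For a probability
   mass function the negative part always has a finite sum, so the value is
   well defined in [\bar R].
   Terms with [q a b = 0] contribute 0, and [q a b > 0] forces both marginals
   to be positive. *)
Definition mutual_info (R : realType) (A B : countType) (q : A -> B -> R)
  : \bar R :=
  (\esum_(ab in [set: A * B]%classic) (mutual_info_term q)^\+ ab
   - \esum_(ab in [set: A * B]%classic) (mutual_info_term q)^\- ab)%E.

(* [n] = {1, ..., n} is represented by ['I_n]. *)
Definition input (n : nat) := {ffun 'I_n -> bool}.

Definition parity (n : nat) (S : {set 'I_n}) (x : input n) : bool :=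
  \big[addb/false]_(i in S) x i.

Definition perfect_matching (n : nat) (M : {set {set 'I_n}}) : bool :=
  [&& #|M| == n./2, [forall e in M, #|e| == 2%N], finset.trivIset M
    & finset.cover M == [set: 'I_n]].

Definition matching (n : nat) :=
  {M : {set {set 'I_n}} | perfect_matching M}.

Definition hm_output (n : nat) (M : matching n) :=
  ({e : {set 'I_n} | e \in val M} * bool)%type.

Definition hm_correct (n : nat) (x : input n) (M : matching n)
  (o : hm_output M) : Prop :=
  exists i j : 'I_n, val o.1 = [set i; j] /\ o.2 = x i (+) x j.

(* [alice x r] is the law of Msg given X = x and R = r; [bob z r M] is the law
   of Bob's output given Msg = z, R = r and his input M.  Private randomness is
   what makes these laws rather than functions. *)
Record protocol (R : realType) (n : nat) := Protocol {
  rand_type : countType ;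
  msg_type : countType ;
  rand : distr R rand_type ;
  alice : input n -> rand_type -> distr R msg_type ;
  bob : msg_type -> rand_type -> forall M : matching n, distr R (hm_output M) }.

Section ProtocolLaws.
Variables (R : realType) (n : nat) (P : protocol R n).

(* Values of C = (Msg, R). *)
Definition transcript : countType := (msg_type P * rand_type P)%type.

(* Pr(C = c | X = x); the public randomness is independent of X. *)
Definition prob_C_given_X (x : input n) (c : transcript) : R :=
  rand P c.2 * alice x c.2 c.1.

(* Pr(X = x, C = c), for X uniform. *)
Definition prob_XC (x : input n) (c : transcript) : R :=
  #|{: input n}|%:R^-1 * prob_C_given_X x c.

(* Pr(X_S = a, C = c). *)
Definition prob_parity_C (S : {set 'I_n}) (a : bool) (c : transcript) : R :=
  \sum_(x : input n | parity S x == a) prob_XC x c.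

(* I(X_S : C). *)
Definition parity_info (S : {set 'I_n}) : \bar R :=
  mutual_info (prob_parity_C S).

Definition zero_error : Prop :=
  forall (x : input n) (c : transcript), 0 < prob_C_given_X x c ->
  forall (M : matching n) (o : hm_output M), 0 < bob c.1 c.2 M o ->
  hm_correct x o.

Definition pohm_private : Prop :=
  forall S : {set 'I_n}, #|S| <> 0%N -> #|S| <> 2%N -> parity_info S = 0%E.

End ProtocolLaws.

(* Main.v *)
(** Fix a transcript c and let A be the set of inputs compatible with it.  Call
    i and j equivalent when x_i + x_j is constant on A; by zero error every
    perfect matching contains an edge between equivalent points.  List the points
    class by class and match the k-th one with the (k + n/2)-th one: the
    equivalent edge of this matching shows that one class has more than n/2,
    hence at least 4, elements.  The parity over 4 points S of that class is
    constant on A, whereas X_S is uniform, so X_S and C are not independent. *)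

Require Import Defs.
From mathcomp Require Import all_boot all_order all_algebra.
From mathcomp Require Import all_classical all_reals ereal numfun esum exp.
From mathcomp Require Import zify ring lra.
Import Order.TTheory GRing.Theory Num.Theory.
Local Open Scope ring_scope.

(** * Sums of extended reals over arbitrary index types *)

Lemma le_esum_term {R : realType} {T : choiceType} (a : T -> \bar R) (t : T) :
  (a t <= \esum_(i in [set: T]%classic) a i)%E.
Proof. by apply: esum_ge; exists [set t]%classic; [split|rewrite fsbig_set1]. Qed.

Lemma esum_finType {R : realType} {T : finType} (a : T -> \bar R) :
  (forall t, 0 <= a t)%E -> (\esum_(t in [set: T]%classic) a t = \sum_t a t)%E.
Proof.
move=> a0; rewrite esum_fset//; last exact: finite_finset.
rewrite (bigfs _ (index_enum_uniq T))// => [|t _].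
  by congr (\sum_(t \in _) a t)%E; apply/seteqP; split.
by rewrite mem_index_enum.
Qed.

(** Bounding each finite partial sum gives one inequality for every positive factor; the other one
    is the same bound for the inverse factor. *)
Lemma esumZl {R : realType} {T : choiceType} (I : set T) (a : T -> \bar R)
    (k : R) : 0 <= k -> (forall i, 0 <= a i)%E ->
  (\esum_(i in I) (k%:E * a i) = k%:E * \esum_(i in I) a i)%E.
Proof.
have le_Z (b : T -> \bar R) (l : R) : 0 < l -> (forall i, 0 <= b i)%E ->
    (\esum_(i in I) (l%:E * b i) <= l%:E * \esum_(i in I) b i)%E.
  move=> l0 b0; apply: ge_ereal_sup => _ [X [finX XI] <-].
  rewrite -ge0_mule_fsumr// lee_pmul2l// esum_ge//.
  by exists X.
rewrite le_eqVlt => /predU1P[<- a0|k0 a0].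
  by rewrite mul0e esum1// => i _; rewrite mul0e.
(* The reverse inequality is [le_Z] with factor [k^-1], applied to the already scaled family. *)
apply/eqP; rewrite eq_le le_Z//= -lee_pdivlMl//.
rewrite -[X in (X <= _)%E](@eq_esum _ _ _ (fun i => k^-1%:E * (k%:E * a i))%E).
  by apply: le_Z; rewrite ?invr_gt0// => i; rewrite mule_ge0// lee_fin ltW.
by move=> i _; rewrite muleA -EFinM mulVf ?gt_eqF// mul1e.
Qed.

Lemma esum_prod {R : realType} {A B : choiceType} (f : A -> B -> \bar R) :
  (forall a b, 0 <= f a b)%E ->
  (\esum_(a in [set: A]%classic) \esum_(b in [set: B]%classic) f a b
   = \esum_(ab in [set: A * B]%classic) f ab.1 ab.2)%E.
Proof.
move=> f0; rewrite esum_esum//; congr esum.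
by apply/seteqP; split => // -[].
Qed.

Lemma exchange_esum {R : realType} {A B : choiceType} (f : A -> B -> \bar R) :
  (forall a b, 0 <= f a b)%E ->
  (\esum_(a in [set: A]%classic) \esum_(b in [set: B]%classic) f a b
   = \esum_(b in [set: B]%classic) \esum_(a in [set: A]%classic) f a b)%E.
Proof.
move=> f0; rewrite !esum_prod//.
apply: (@reindex_esum _ _ _ _ _ (fun ba => (ba.2, ba.1))); split=> //.
- by move=> [b a] [b' a'] _ _ [-> ->].
- by move=> [a b] _; exists (b, a).
Qed.

(** * Vanishing mutual information and supports *)

(** This is [ln t <= t - 1] at [t = s / q], multiplied by [q]. When [q = 0] the logarithm is killed
    by its factor and only [- s <= 0] remains. *)
Lemma ln_mass_ge {R : realType} (q s : R) : 0 <= q -> (0 < q -> 0 < s) ->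
  0 <= s -> q - s <= q * ln (q / s).
Proof.
move=> q0 qs s0; have [->|qn0] := eqVneq q 0.
  by rewrite mul0r sub0r oppr_le0.
have {q0} q0 : 0 < q by rewrite lt_neqAle eq_sym qn0.
have {s0} s0 := qs q0.
have h : ln (s / q) <= s / q - 1.
  have := @le_ln1Dx R (s / q - 1); rewrite addrCA subrr addr0; apply.
  by rewrite ltrBDr addrC subrr divr_gt0.
have -> : q - s = q * (1 - s / q) by field.
rewrite ler_pM2l// -[q / s]invf_div lnV ?posrE ?divr_gt0//.
by rewrite lerNr opprB.
Qed.

(* Summing the nonnegative gaps [D] between the two sides of [ln_mass_ge] gives
   [ln 2 * I(A : B)], so at [I = 0] every gap vanishes. *)
Lemma mutual_info0_support {R : realType} {A B : countType}
    (q : A -> B -> R) (a0 a1 : A) (b0 b1 : B) :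
  (forall a b, 0 <= q a b) ->
  (\esum_(a in [set: A]%classic) \esum_(b in [set: B]%classic) (q a b)%:E = 1)%E ->
  mutual_info q = 0%E ->
  0 < q a0 b1 -> 0 < q a1 b0 -> 0 < q a0 b0.
Proof.
move=> q0 q1 I0.
have q0E x y : (0 <= (q x y)%:E)%E by rewrite lee_fin.
have row0 x : (0 <= \esum_(y in [set: B]%classic) (q x y)%:E)%E by exact: esum_ge0.
have col0 y : (0 <= \esum_(x in [set: A]%classic) (q x y)%:E)%E by exact: esum_ge0.
have swapE : (\esum_(y in [set: B]%classic) \esum_(x in [set: A]%classic) (q x y)%:E = 1)%E.
  by rewrite -exchange_esum.
have fin1 (T : choiceType) (f : T -> \bar R) t : (forall t, 0 <= f t)%E ->
    (\esum_(t in [set: T]%classic) f t = 1)%E -> f t \is a fin_num.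
  move=> f0 f1; rewrite ge0_fin_numE//.
  by rewrite (le_lt_trans (le_esum_term f t))// f1 ltry.
have m1E a : (marginal1 q a)%:E = (\esum_(b in [set: B]%classic) (q a b)%:E)%E.
  by rewrite fineK// (fin1 _ (fun a => \esum_(b in [set: B]%classic) (q a b)%:E)%E).
have m2E b : (marginal2 q b)%:E = (\esum_(a in [set: A]%classic) (q a b)%:E)%E.
  by rewrite fineK// (fin1 _ (fun b => \esum_(a in [set: A]%classic) (q a b)%:E)%E).
have m1_ge a b : q a b <= marginal1 q a.
  by rewrite -lee_fin m1E (le_esum_term (fun b => (q a b)%:E)).
have m2_ge a b : q a b <= marginal2 q b.
  by rewrite -lee_fin m2E (le_esum_term (fun a => (q a b)%:E)).
have m1_ge0 a : 0 <= marginal1 q a by rewrite -lee_fin m1E.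
have m2_ge0 b : 0 <= marginal2 q b by rewrite -lee_fin m2E.
pose s a b := marginal1 q a * marginal2 q b.
have s0 a b : 0 <= s a b by rewrite mulr_ge0.
have s1 : (\esum_(ab in [set: A * B]%classic) (s ab.1 ab.2)%:E = 1)%E.
  rewrite -(esum_prod (fun a b => (s a b)%:E)) => [|a b]; last by rewrite lee_fin.
  rewrite -q1; apply: eq_esum => a _.
  under eq_esum do rewrite /s EFinM.
  rewrite esumZl => [|//|y]; last by rewrite lee_fin.
  by under eq_esum do rewrite m2E; rewrite swapE mule1 m1E.
have ln2_gt0 : 0 < ln 2 :> R by rewrite ln_gt0// ltr1n.
pose D a b := q a b * ln (q a b / s a b) - (q a b - s a b).
have D0 a b : 0 <= D a b.
  rewrite subr_ge0 ln_mass_ge// => qab.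
  by rewrite mulr_gt0//; exact: lt_le_trans qab _.
pose t := mutual_info_term q.
have tE ab : ((ln 2)%:E * t ab
    = (q ab.1 ab.2 * ln (q ab.1 ab.2 / s ab.1 ab.2))%:E)%E.
  case: ab => a b; rewrite /t /= -EFinM; congr EFin.
  by rewrite mulrCA /log2 (mulrC (ln 2)) divfK ?gt_eqF.
(* The identity defining [D], with every negative quantity moved across, so that both sides are
   nonnegative and can be summed term by term. *)
have balance ab : ((ln 2)%:E * t^\+ ab + (s ab.1 ab.2)%:E
    = (ln 2)%:E * t^\- ab + ((q ab.1 ab.2)%:E + (D ab.1 ab.2)%:E))%E.
  have := tE ab; rewrite funeposE funenegE.
  have -> : t ab = (fine (t ab))%:E by rewrite /t; case: ab.
  rewrite -EFinM => -[]; rewrite /D -EFinN -!EFin_max -!EFinM -!EFinD => <-.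
  have -> : Num.max (fine (t ab)) 0 = fine (t ab) + Num.max (- fine (t ab)) 0.
    move: (fine _) => x; have /orP[x0|x0] := le_total x 0.
      by rewrite (max_r x0) max_l ?oppr_ge0// subrr.
    by rewrite (max_l x0) max_r ?oppr_le0// addr0.
  by congr EFin; ring.
have Dsum : (\esum_(ab in [set: A * B]%classic) (D ab.1 ab.2)%:E = 0)%E.
  have tp0 ab : (0 <= t^\+ ab)%E by exact: funepos_ge0.
  have tn0 ab : (0 <= t^\- ab)%E by exact: funeneg_ge0.
  have sE0 ab : (0 <= (s ab.1 ab.2)%:E)%E by rewrite lee_fin.
  have DE0 ab : (0 <= (D ab.1 ab.2)%:E)%E by rewrite lee_fin.
  have ln2E : (0 <= (ln 2 : R)%:E)%E by rewrite lee_fin ltW.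
  have : (\esum_(ab in [set: A * B]%classic) ((ln 2)%:E * t^\+ ab + (s ab.1 ab.2)%:E)
      = \esum_(ab in [set: A * B]%classic)
          ((ln 2)%:E * t^\- ab + ((q ab.1 ab.2)%:E + (D ab.1 ab.2)%:E)))%E.
    by apply: eq_esum => ab _; exact: balance.
  rewrite !esumD; try by move=> *; rewrite ?adde_ge0 ?mule_ge0.
  rewrite !esumZl// s1 -(esum_prod (fun a b => (q a b)%:E))// q1.
  move: I0; rewrite /mutual_info -/t.
  have := @esum_ge0 _ _ [set: A * B]%classic _ (fun ab _ => tp0 ab).
  have := @esum_ge0 _ _ [set: A * B]%classic _ (fun ab _ => tn0 ab).
  have := @esum_ge0 _ _ [set: A * B]%classic _ (fun ab _ => DE0 ab).
  move: (\esum_(ab in _) (D _ _)%:E)%E => d.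
  move: (\esum_(ab in _) t^\+ ab)%E (\esum_(ab in _) t^\- ab)%E => x y.
  (* Infinite values are excluded: [x - y = 0] forces [x] and [y] to be finite, since [+oo - +oo] is
     [-oo], and the summed balance then makes [d] finite. *)
  case: x => [x| |]; case: y => [y| |]; case: d => [d| |] //= d0 y0 x0.
  rewrite -EFinD -!EFinM -!EFinD => -[xy] -[e]; congr EFin.
  by move: e; rewrite (subr0_eq xy); lra.
(* If [q a0 b0] were 0, the gap at that point would be the product of the marginals of [a0] and
   [b0], which [q a0 b1] and [q a1 b0] make positive. *)
move=> qa0 qb0; rewrite lt_neqAle q0 andbT; apply/negP => /eqP qab.
have : ((D a0 b0)%:E <= 0)%E.
  by rewrite -Dsum (le_esum_term (fun ab => (D ab.1 ab.2)%:E) (a0, b0)).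
rewrite lee_fin /D -qab mul0r sub0r opprB subr0 leNgt mulr_gt0//.
- exact: lt_le_trans qa0 (m1_ge _ _).
- exact: lt_le_trans qb0 (m2_ge _ _).
Qed.

(** * A perfect matching adapted to a colouring of the points *)

(** In a list sorted by colour, two entries of one colour at distance [n./2] enclose only entries of
    that colour, which makes [n./2 + 1] of them counting both ends. *)
Lemma perfect_matching_fiber {n : nat} {T : countType} (f : 'I_n -> T) :
  (0 < n)%N -> ~~ odd n ->
  exists M : {set {set 'I_n}}, perfect_matching M /\
    forall i j, [set i; j] \in M -> f i = f j ->
      (n./2 < #|[set k | f k == f i]|)%N.
Proof.
move=> n0 evn.
have nE : n = (n./2 + n./2)%N by rewrite addnn even_halfK.
set h := n./2 in nE *.
(* The countable type [T] carries no order of its own; its numbering supplies one, and injectivity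
   of the numbering recovers equality of colours. *)
pose g i := pickle (f i).
pose s := sort (relpre g leq) (enum 'I_n).
pose v k := nth (Ordinal n0) s k.
have sz : size s = n by rewrite size_sort size_enum_ord.
have us : uniq s by rewrite sort_uniq enum_uniq.
have v_inj k l : (k < n)%N -> (l < n)%N -> v k = v l -> k = l.
  by move=> kn ln /eqP; rewrite nth_uniq ?sz// => /eqP.
have v_homo k l : (k <= l)%N -> (l < n)%N -> (g (v k) <= g (v l))%N.
  move=> kl ln.
  have ss : sorted (relpre g leq) s by apply: sort_sorted => x y; exact: leq_total.
  have tr : transitive (relpre g leq) by move=> x y z; exact: leq_trans.
  have rfl : reflexive (relpre g leq) by move=> x; exact: leqnn.
  by apply: (sorted_leq_nth tr rfl) => //; rewrite inE sz// (leq_ltn_trans kl).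
pose M := [set [set v k; v (h + k)%N] | k : 'I_h].
have card2 e : e \in M -> #|e| = 2%N.
  case/imsetP => k _ ->; rewrite cards2; case: eqP => // /v_inj.
  by have := ltn_ord k; lia.
have covM : finset.cover M = [set: 'I_n].
  apply/setP => i; rewrite inE; apply/bigcupP.
  have is_ : i \in s by rewrite mem_sort mem_enum.
  have vi : v (index i s) = i by exact: nth_index.
  have := is_; rewrite -index_mem sz.
  have [ih _|hi i_n] := ltnP (index i s) h.
    exists [set v (Ordinal ih); v (h + Ordinal ih)%N]; first exact: imset_f.
    by rewrite !inE /= vi eqxx.
  have kh : (index i s - h < h)%N by lia.
  exists [set v (Ordinal kh); v (h + Ordinal kh)%N]; first exact: imset_f.
  by rewrite !inE /= subnKC// vi eqxx orbT.
have sumM : (\sum_(e in M) #|e| = #|M| * 2)%N.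
  by rewrite -sum_nat_const; apply: eq_bigr => e /card2.
(* Counting alone yields disjointness: at most h edges of size 2 cover 2h points. *)
have leM : (#|M| <= h)%N by rewrite (leq_trans (leq_imset_card _ _))// card_ord.
have := leq_card_cover M; rewrite covM cardsT card_ord sumM => -[geM eqM].
have cM : #|M| = h by lia.
exists M; split.
  apply/and4P; split; [exact/eqP|by apply/forall_inP => e /card2/eqP|by rewrite -eqM cM muln2 -addnn -nE|exact/eqP].
move=> i j /imsetP[k _ eij] fij; have kh := ltn_ord k.
(* The edge is known only as an unordered pair, but [f i = f j] makes its orientation irrelevant. *)
have fk : f (v k) = f i /\ f (v (h + k)%N) = f i.
  have := set21 (v k) (v (h + k)%N); have := set22 (v k) (v (h + k)%N).
  by rewrite -eij !inE => /orP[]/eqP-> /orP[]/eqP->.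
(* Monotonicity of [g] along [s] squeezes the value at [k + l] between the equal values at [k] and
   [h + k]. *)
have fl (l : 'I_h.+1) : f (v (k + l)%N) = f i.
  have lh := ltn_ord l.
  apply: (pcan_inj pickleK); apply/eqP; rewrite eqn_leq.
  have := v_homo (k + l)%N (h + k)%N; have := v_homo k (k + l)%N.
  rewrite /g fk.1 fk.2; lia.
have inj_w : injective (fun l : 'I_h.+1 => v (k + l)%N).
  move=> l l' /v_inj; have := ltn_ord l; have := ltn_ord l' => ll' ll e.
  by apply/val_inj => /=; lia.
rewrite -[X in (X <= _)%N]card_ord -(card_imset _ inj_w).
by apply/subset_leq_card/fintype.subsetP => _ /imsetP[l _ ->]; rewrite inE fl.
Qed.

(** * Parities fixed by a zero-error transcript *)

(** The two parities differ by the sum over [S] of [x i (+) y i], an even number of copies of one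
    bit. *)
Lemma parity_const_shift {n : nat} (S : {set 'I_n}) (x y : input n) :
  ~~ odd #|S| -> {in S &, forall i j, x i (+) y i = x j (+) y j} ->
  parity S x = parity S y.
Proof.
move=> evS shift_eq; have [->|[i0 i0S]] := set_0Vmem S.
  by rewrite /parity !big_set0.
have iter_addb b m : iter m (addb b) false = b && odd m.
  by elim: m => [|m /= ->]; case: b => //=; case: odd.
have : parity S x (+) parity S y = false.
  rewrite /parity -big_split (eq_bigr (fun=> x i0 (+) y i0)) /= => [|i iS].
    by rewrite big_const iter_addb (negbTE evS) andbF.
  exact: shift_eq.
by case: (parity S x) (parity S y) => -[].
Qed.

Lemma distr_gt0 {R : realType} {T : countType} (p : distr R T) :
  exists t, 0 < p t.
Proof.
apply: contrapT => /forallNP p0; have := distr_sum1 p.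
rewrite esum1 => [/esym/eqP|t _]; first by rewrite onee_eq0.
congr EFin; apply/eqP; rewrite eq_le distr_ge0 andbT leNgt.
exact/negP/p0.
Qed.

Lemma exists_subset_card {T : finType} (A : {set T}) (k : nat) :
  (k <= #|A|)%N -> exists S : {set T}, S \subset A /\ #|S| = k.
Proof.
move=> kA; exists [set x in take k (enum A)]; split.
  by apply/fintype.subsetP => x; rewrite inE => /mem_take; rewrite mem_enum.
rewrite cardsE (card_uniqP _) ?take_uniq ?enum_uniq//.
by rewrite size_take_min -cardE; apply/minn_idPl.
Qed.

(** The endpoints hidden in [hm_correct] may come in either order; the exclusive or is symmetric. *)
Lemma hm_correct_edge {n : nat} (x : input n) (M : matching n)
    (o : hm_output M) (i j : 'I_n) :
  hm_correct x o -> val o.1 = [set i; j] -> o.2 = x i (+) x j.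
Proof.
move=> [k [l [-> ->]]] e.
have := set21 k l; have := set22 k l; have := set21 i j; have := set22 i j.
rewrite {1 2}e -{1 2}e !inE.
by do 4! move=> /orP[]/eqP ?; subst; rewrite // addbC.
Qed.

Lemma zero_error_parity_fixed {R : realType} {n : nat} (P : protocol R n)
    (c : transcript P) (x0 : input n) :
  (6 <= n)%N -> ~~ odd n -> zero_error P -> 0 < prob_C_given_X x0 c ->
  exists S : {set 'I_n}, #|S| = 4%N /\
    forall x, 0 < prob_C_given_X x c -> parity S x = parity S x0.
Proof.
move=> n6 evn ze x0c.
(* Equal keys encode the equivalence of points: [key i = key j] means that every compatible [x] has
   [x i (+) x j = x0 i (+) x0 j]. *)
pose key i := [set x : input n | (0 < prob_C_given_X x c) && (x i (+) x0 i)].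
have n0 : (0 < n)%N by exact: leq_trans n6.
have [M [pM fibM]] := perfect_matching_fiber key n0 evn.
(* One output of positive probability suffices: it does not depend on the input, so its bit is the
   value of [x i (+) x j] for all compatible inputs at once. *)
have [[e b] bob_e] := distr_gt0 (bob c.1 c.2 (Sub M pM : matching n)).
have [i [j [/= eij _]]] := ze _ _ x0c _ _ bob_e.
have keyij : key i = key j.
  apply/setP => x; rewrite !inE; case: ltP => //= xc.
  have xb := hm_correct_edge _ _ _ _ _ (ze _ _ xc _ _ bob_e) eij.
  have x0b := hm_correct_edge _ _ _ _ _ (ze _ _ x0c _ _ bob_e) eij.
  move: x0b; rewrite xb /=.
  by case: (x i) (x j) (x0 i) (x0 j) => -[] [] [].
have := fibM i j; rewrite -eij => /(_ (valP e) keyij).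
move=> fib; have [|S [/fintype.subsetP SF S4]] :=
    exists_subset_card [set k | key k == key i] 4; first by apply: leq_trans fib; lia.
exists S; split=> // x xc; apply: parity_const_shift => [|k l kS lS].
  by rewrite S4.
have : key k = key l.
  by have := SF _ kS; have := SF _ lS; rewrite !inE => /eqP-> /eqP->.
by move/setP/(_ x); rewrite !inE xc.
Qed.

(** * The joint law of [X_S] and [C], and the contradiction *)

Lemma prob_XC_ge0 {R : realType} {n : nat} (P : protocol R n) x c :
  0 <= prob_XC (P := P) x c.
Proof. by rewrite !mulr_ge0 ?invr_ge0 ?ler0n ?distr_ge0. Qed.

Lemma esum_prob_C_given_X {R : realType} {n : nat} (P : protocol R n) x :
  (\esum_(c in [set: transcript P]%classic) (prob_C_given_X x c)%:E = 1)%E.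
Proof.
have p0 z r : (0 <= (rand P r * alice x r z)%:E)%E.
  by rewrite lee_fin mulr_ge0 ?distr_ge0.
(* With the sum over messages innermost, Alice's law for fixed [r] sums to 1 and leaves the law of
   the public randomness. *)
rewrite -(esum_prod (fun z r => (rand P r * alice x r z)%:E))// exchange_esum//.
rewrite -[RHS](distr_sum1 (rand P)); apply: eq_esum => r _.
under eq_esum do rewrite EFinM.
rewrite esumZl ?distr_ge0// ?distr_sum1 ?mule1// => z.
by rewrite lee_fin distr_ge0.
Qed.

(** Supplies the total mass needed by [mutual_info0_support]: each input has weight [N^-1] and lies
    in exactly one parity class. *)
Lemma esum_prob_parity_C {R : realType} {n : nat} (P : protocol R n)
    (S : {set 'I_n}) :
  (\esum_(a in [set: bool]%classic) \esum_(c in [set: transcript P]%classic)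
     (prob_parity_C S a c)%:E = 1)%E.
Proof.
pose N := #|{: input n}|.
have N0 : (N%:R : R) != 0.
  by rewrite pnatr_eq0 -lt0n; apply/card_gt0P; exists [ffun=> false].
rewrite esum_finType => [|a]; last first.
  apply: esum_ge0 => c _; rewrite lee_fin; apply: sumr_ge0 => x _.
  exact: prob_XC_ge0.
transitivity (\sum_(a : bool) \sum_(x : input n | parity S x == a) (N%:R^-1 : R)%:E)%E.
  apply: eq_bigr => a _; under eq_esum do rewrite /prob_parity_C -sumEFin.
  rewrite esum_sum => [|c x _ _]; last by rewrite lee_fin prob_XC_ge0.
  apply: eq_bigr => x _; under eq_esum do rewrite /prob_XC EFinM.
  rewrite esumZl ?invr_ge0 ?ler0n// ?esum_prob_C_given_X ?mule1// => c.
  by rewrite lee_fin mulr_ge0 ?distr_ge0.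
transitivity (\sum_(x : input n) (N%:R^-1 : R)%:E)%E.
  by rewrite [RHS](partition_big (parity S) xpredT).
rewrite sumEFin sumr_const -/N.
by rewrite -[_ *+ _]mulr_natr mulVf.
Qed.

Lemma prob_parity_C_gt0 {R : realType} {n : nat} (P : protocol R n)
    (S : {set 'I_n}) (x : input n) (c : transcript P) :
  0 < prob_C_given_X x c -> 0 < prob_parity_C S (parity S x) c.
Proof.
move=> xc; rewrite /prob_parity_C (bigD1 x)//=.
apply: ltr_wpDr; first by apply: sumr_ge0 => y _; exact: prob_XC_ge0.
rewrite mulr_gt0// invr_gt0 ltr0n; apply/card_gt0P; by exists x.
Qed.

Lemma exists_transcript {R : realType} {n : nat} (P : protocol R n)
    (x : input n) : exists c : transcript P, 0 < prob_C_given_X x c.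
Proof.
have [r r0] := distr_gt0 (rand P); have [z z0] := distr_gt0 (alice x r).
by exists (z, r); rewrite mulr_gt0.
Qed.

Lemma parity_onto {n : nat} (S : {set 'I_n}) (b : bool) :
  S != finset.set0 -> exists x : input n, parity S x = b.
Proof.
case/set0Pn => i iS; exists [ffun j => b && (j == i)].
rewrite /parity (bigD1 i)//= ffunE eqxx andbT big1 ?addbF// => j /andP[_ /negbTE ji].
by rewrite ffunE ji andbF.
Qed.

Theorem theorem1 (R : realType) (n : nat) (hn : (6 <= n)%N) (hev : ~~ odd n) :
  (~ exists P : protocol R n,
       zero_error P /\
       (forall S : {set 'I_n}, #|S| = 4%N -> parity_info P S = 0%E)) /\
  (~ exists P : protocol R n, zero_error P /\ pohm_private P).
Proof.
suff no4 : ~ exists P : protocol R n, zero_error P /\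
    (forall S : {set 'I_n}, #|S| = 4%N -> parity_info P S = 0%E).
  split=> // -[P [ze priv]]; apply: no4; exists P; split=> // S S4.
  by apply: priv; rewrite S4.
move=> [P [ze priv]].
have [c x0c] := exists_transcript P [ffun=> false].
have [S [S4 fixed]] := zero_error_parity_fixed P c _ hn hev ze x0c.
have S0 : S != finset.set0 by rewrite -card_gt0 S4.
(* An input of the opposite parity, with any transcript [c1] it can produce, shows that this parity
   value has positive probability. Independence would then make it possible jointly with [c]. *)
have [x1 x1S] := parity_onto S (~~ parity S [ffun=> false]) S0.
have [c1 x1c1] := exists_transcript P x1.
have q_ge0 a c' : 0 <= prob_parity_C (P := P) S a c'.
  by apply: sumr_ge0 => x _; exact: prob_XC_ge0.
have := mutual_info0_support _ _ _ _ _ q_ge0 (esum_prob_parity_C P S) (priv _ S4)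
  (prob_parity_C_gt0 P S _ _ x1c1) (prob_parity_C_gt0 P S _ _ x0c).
(* By [fixed], no input of the opposite parity is compatible with [c], so this joint probability is
   a sum of zeros. *)
rewrite /prob_parity_C big1 ?ltxx// => x /eqP xS.
have [/fixed|] := ltP 0 (prob_C_given_X x c); first by rewrite xS x1S; case: parity.
move=> xc; apply/eqP; rewrite eq_le prob_XC_ge0 andbT.
by rewrite mulr_ge0_le0 ?invr_ge0.
Qed.
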